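(* Let $F=\langle\mathcal{A},\mathcal{R}\rangle$ be a finite argumentation framework. Let $F_{\mathrm{IRR}}=\langle\mathrm{IRR}(F),\mathcal{R}_{\mathrm{IRR}}\rangle$ be the argumentation framework whose arguments are the irreducible self-defending sets of $F$ and where $$\mathcal{R}_{\mathrm{IRR}}=\{(S_1,S_2)\mid S_1,S_2\in\mathrm{IRR}(F)\text{ and } S_1\cup S_2\notin\mathrm{ADM}(F)\}.$$ Then $$\mathrm{PREF}(F)=\left\{\bigcup\mathcal{I}\ \middle|\ \mathcal{I}\in\mathrm{NAIV}(F_{\mathrm{IRR}})\right\},$$ and moreover the map $\mathcal{I}\mapsto\bigcup\mathcal{I}$ is a bijection between $\mathrm{NAIV}(F_{\mathrm{IRR}})$ and $\mathrm{PREF}(F)$.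
   Context: All objects are finite. An argumentation framework is a pair $F=\langle \mathcal{A},\mathcal{R}\rangle$ where $\mathcal{A}$ is a finite set (of arguments) and $\mathcal{R}\subseteq\mathcal{A}\times\mathcal{A}$ (attacks; self-attacks are allowed). For $S\subseteq\mathcal{A}$: $S^+=\{x\in\mathcal{A}\mid \exists y\in S,\ (y,x)\in\mathcal{R}\}$ and $S^-=\{x\in\mathcal{A}\mid \exists y\in S,\ (x,y)\in\mathcal{R}\}$. A set $S\subseteq\mathcal{A}$ is conflict-free if $S\cap S^+=\emptyset$; naive sets are the inclusion-wise maximal conflict-free sets, forming the family $\mathrm{NAIV}(F)$. $S$ is self-defending if $S^-\subseteq S^+$; $\mathrm{SD}(F)$ is the family of self-defending sets. $S$ is admissible if it is conflict-free and self-defending; $\mathrm{ADM}(F)$ is the family of admissible sets. Preferred extensions are the inclusion-wise maximal admissible sets, forming the family $\mathrm{PREF}(F)$. A self-defending set $S\in\mathrm{SD}(F)$ with $S\neq\emptyset$ is irreducible if for all $S_1,S_2\in\mathrm{SD}(F)$, $S=S_1\cup S_2$ implies $S=S_1$ or $S=S_2$. $\mathrm{IRR}(F)$ denotes the family of irreducible self-defending sets of $F$. *)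

(* Defs.v *)
From HB Require Import structures.
From mathcomp Require Import all_boot.

Set Implicit Arguments.
Unset Strict Implicit.
Unset Printing Implicit Defensive.

(* The finite set of arguments is the carrier [arg]; [attacks F x y] means that
   the pair (x, y) is in the attack relation. *)
Record framework := Framework { arg :> finType; attacks : rel arg }.

Section Semantics.
Variable F : framework.
Implicit Types S : {set F}.

(* The sets S^+ and S^-. *)
Definition attacked_by S : {set F} := [set x | [exists y in S, attacks y x]].
Definition attackers_of S : {set F} := [set x | [exists y in S, attacks x y]].

Definition conflict_free S : bool := S :&: attacked_by S == set0.
Definition self_defending S : bool := attackers_of S \subset attacked_by S.
Definition admissible S : bool := conflict_free S && self_defending S.

Definition NAIV : {set {set F}} := [set S | maxset conflict_free S].
Definition SD : {set {set F}} := [set S | self_defending S].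
Definition ADM : {set {set F}} := [set S | admissible S].
Definition PREF : {set {set F}} := [set S | maxset admissible S].

Definition irreducible S : bool :=
  (S != set0) &&
  [forall S1 in SD, forall S2 in SD,
     (S == S1 :|: S2) ==> (S == S1) || (S == S2)].

Definition IRR : {set {set F}} := [set S in SD | irreducible S].

End Semantics.

(* The arguments are the members of [IRR F], packed as a subtype of {set F};
   [val] recovers the underlying subset of F. *)
Definition irr_framework (F : framework) : framework :=
  @Framework {S : {set F} | S \in IRR F}
    (fun S1 S2 => val S1 :|: val S2 \notin ADM F).

Definition irr_union (F : framework) (I : {set irr_framework F}) : {set F} :=
  \bigcup_(S in I) val S.

Definition bijection_between (X Y : finType) (f : X -> Y)
    (A : {set X}) (B : {set Y}) : Prop :=
  [/\ {in A, forall x, f x \in B},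
      {in A &, injective f}
    & {in B, forall y, exists2 x, x \in A & f x = y}].

(* Main.v *)
(** A set of irreducible self-defending sets is conflict-free in [irr_framework F]
    iff its union is admissible in [F]: self-defence is stable under unions, and
    conflicts are witnessed by pairs.  Every self-defending set is the union of
    the irreducible ones below it, so [irr_union] and [irr_below] form a Galois
    connection that matches maximal elements on both sides. *)
Require Import Defs.
From HB Require Import structures.
From mathcomp Require Import all_boot.

Set Implicit Arguments.
Unset Strict Implicit.
Unset Printing Implicit Defensive.

Section SelfDefence.
Variable F : framework.
Implicit Types S T : {set F}.

Lemma conflict_freeP S :
  reflect {in S &, forall x y, ~~ attacks x y} (conflict_free S).
Proof.
apply: (iffP eqP) => [S0 x y xS yS | noatt].
  apply/negP => xy; have: y \in S :&: attacked_by S.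
    by rewrite !inE yS; apply/existsP; exists x; rewrite xS.
  by rewrite S0 inE.
apply/setP => y; rewrite !inE; apply/andP => -[yS /existsP[x /andP[xS xy]]].
by have := noatt x y xS yS; rewrite xy.
Qed.

Lemma conflict_freeS S T : S \subset T -> conflict_free T -> conflict_free S.
Proof.
move=> /subsetP sST /conflict_freeP cfT; apply/conflict_freeP => x y xS yS.
exact: cfT (sST _ xS) (sST _ yS).
Qed.

Lemma self_defendingP S :
  reflect (forall x y, y \in S -> attacks x y ->
             exists2 z, z \in S & attacks z x)
          (self_defending S).
Proof.
apply: (iffP subsetP) => [sd x y yS xy | sd x].
  have: x \in attacked_by S.
    by apply: sd; rewrite inE; apply/existsP; exists y; rewrite yS.
  by rewrite inE => /exists_inP.
rewrite !inE => /exists_inP[y yS xy]; apply/exists_inP; exact: sd yS xy.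
Qed.

Lemma self_defending_bigcup (I : finType) (P : pred I) (E : I -> {set F}) :
  (forall i, P i -> self_defending (E i)) ->
  self_defending (\bigcup_(i | P i) E i).
Proof.
move=> sdE; apply/self_defendingP => x y /bigcupP[i Pi yi] xy.
have [z zi zx] := self_defendingP _ (sdE i Pi) x y yi xy.
by exists z => //; apply/bigcupP; exists i.
Qed.

Lemma self_defendingU S T :
  self_defending S -> self_defending T -> self_defending (S :|: T).
Proof.
move=> sdS sdT; apply/self_defendingP => x y /setUP[yS | yT] xy.
  have [z zS zx] := self_defendingP _ sdS x y yS xy.
  by exists z; rewrite // inE zS.
have [z zT zx] := self_defendingP _ sdT x y yT xy.
by exists z; rewrite // inE zT orbT.
Qed.

End SelfDefence.

Section Irreducible.
Variable F : framework.
Implicit Types (S P : {set F}) (I : {set irr_framework F}).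

Definition irr_below P : {set irr_framework F} :=
  [set S : irr_framework F | val S \subset P].

(** The adjunction: all later passages between inclusions in [F] and inclusions in [irr_framework F]
    go through it. *)
Lemma irr_union_subset I P : (irr_union I \subset P) = (I \subset irr_below P).
Proof.
apply/bigcupsP/subsetP => sIP S SI; first by rewrite inE; apply: sIP.
by have:= sIP S SI; rewrite inE.
Qed.

Lemma self_defending_val (S : irr_framework F) : self_defending (val S).
Proof. by have:= valP S; rewrite !inE => /andP[]. Qed.

Lemma self_defending_irr_union I : self_defending (irr_union I).
Proof. by apply: self_defending_bigcup => S _; apply: self_defending_val. Qed.

(** Strong induction on the cardinality of [P]: a nonempty reducible [P] splits into two
    self-defending sets, both strictly smaller, whose irreducible subsets are also below [P]. *)
Lemma irr_union_below P : self_defending P -> irr_union (irr_below P) = P.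
Proof.
have [n] := ubnP #|P|; elim: n P => // n IHn P /ltnSE leP sdP.
(* One inclusion is the counit of the adjunction; only [P \subset irr_union (irr_below P)]
   remains. *)
apply/eqP; rewrite eqEsubset irr_union_subset subxx /=.
have [-> | P0] := eqVneq P set0; first exact: sub0set.
have [irrP | ] := boolP (irreducible P).
  have PI : P \in IRR F by rewrite !inE sdP.
  apply: (@bigcup_sup _ _ (exist _ P PI : irr_framework F)).
  by rewrite inE /=.
rewrite /irreducible P0 /= => /forall_inPn[S1 + /forall_inPn[S2]].
rewrite !inE negb_imply negb_or => sd1 sd2 /and3P[/eqP defP neP1 neP2].
have sub_below S : S \subset P -> P != S -> self_defending S ->
    S \subset irr_union (irr_below P).
  move=> sSP neS sdS; rewrite -{1}(IHn S) //.
    rewrite irr_union_subset; apply/subsetP => T.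
    rewrite inE => sTS; rewrite inE.
    apply: (@bigcup_sup _ _ T); rewrite inE; exact: subset_trans sTS sSP.
  by apply: leq_trans leP; rewrite proper_card // properEneq eq_sym neS.
by rewrite {1}defP subUset !sub_below // defP (subsetUl, subsetUr).
Qed.

(** An attack inside the union has its ends in two members of [I], so it already spoils their
    pairwise union. Conversely, a pairwise union is self-defending and inherits conflict-freeness
    from the whole union. *)
Lemma conflict_free_irr I : conflict_free I = admissible (irr_union I).
Proof.
rewrite /admissible self_defending_irr_union andbT.
apply/conflict_freeP/idP => [cfI | cfU S T SI TI].
  (* [S] and [T] may coincide: a member with an internal conflict attacks itself in
     [irr_framework F]. *)
  apply/conflict_freeP => x y /bigcupP[S SI xS] /bigcupP[T TI yT].
  have:= cfI S T SI TI; rewrite /= negbK inE => /andP[/conflict_freeP cfST _].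
  by apply: cfST; rewrite inE ?xS ?yT ?orbT.
rewrite /= negbK inE /admissible self_defendingU ?self_defending_val // andbT.
by apply: conflict_freeS cfU; rewrite subUset (bigcup_sup S) ?(bigcup_sup T).
Qed.

(** [irr_below (irr_union I)] contains [I] and has the same union, so it is conflict-free too, and
    maximality of [I] forces equality. *)
Lemma irr_below_union I :
  I \in NAIV (irr_framework F) -> irr_below (irr_union I) = I.
Proof.
rewrite inE => /maxsetP[cfI maxI]; apply: maxI.
  rewrite conflict_free_irr irr_union_below -?conflict_free_irr //.
  exact: self_defending_irr_union.
by rewrite -irr_union_subset.
Qed.

Lemma irr_union_PREF I :
  I \in NAIV (irr_framework F) -> irr_union I \in PREF F.
Proof.
rewrite !inE => /maxsetP[cfI maxI]; apply/maxsetP.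
split=> [|P admP sUP]; first by rewrite -conflict_free_irr.
(* [irr_below P] is conflict-free and contains [I], hence equals it; taking unions gives [P]. *)
have /andP[_ sdP] := admP; rewrite -(maxI (irr_below P)) ?irr_union_below //.
  by rewrite conflict_free_irr irr_union_below.
by rewrite -irr_union_subset.
Qed.

Lemma irr_below_NAIV P :
  P \in PREF F -> irr_below P \in NAIV (irr_framework F).
Proof.
rewrite !inE => /maxsetP[admP maxP]; have /andP[_ sdP] := admP.
apply/maxsetP; rewrite conflict_free_irr irr_union_below //.
split=> // J; rewrite conflict_free_irr => admJ sPJ.
(* Maximality of [P] will turn this inclusion into an equality, and the adjunction then puts [J]
   inside [irr_below P]. *)
have sPU : P \subset irr_union J.
  rewrite -(irr_union_below sdP) irr_union_subset.
  by apply: subset_trans sPJ _; rewrite -irr_union_subset.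
by apply/eqP; rewrite eqEsubset sPJ andbT -irr_union_subset (maxP _ admJ sPU).
Qed.

End Irreducible.

Theorem lemma4 (F : framework) :
  PREF F = [set irr_union I | I in NAIV (irr_framework F)] /\
  bijection_between (@irr_union F) (NAIV (irr_framework F)) (PREF F).
Proof.
have surj P : P \in PREF F ->
    exists2 I, I \in NAIV (irr_framework F) & irr_union I = P.
  move=> PP; exists (irr_below P); first exact: irr_below_NAIV.
  by apply: irr_union_below; move: PP; rewrite inE => /maxsetp/andP[].
split; last split=> //.
- apply/setP => P; apply/idP/imsetP => [/surj[I NI <-] | [I NI ->]].
    by exists I.
  exact: irr_union_PREF.
- exact: irr_union_PREF.
(* On naive sets, [irr_below] is a left inverse of [irr_union]. *)
- move=> I J NI NJ eqIJ.
  by rewrite -(irr_below_union NI) eqIJ irr_below_union.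
Qed.
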